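(* Let $n \ge 2$ be an integer and let $T_\Gamma(\mathbb{Z}_n)$ be the total graph of $\mathbb{Z}_n$. Let $p$ be a prime number. Then: (1) If $n$ is even, then $$SO(T_\Gamma(\mathbb{Z}_n)) = \frac{n(n-\phi(n)-1)^2}{\sqrt{2}}.$$ (2) If $n=p^\alpha$ with $\alpha \geq 1$ an integer and $p > 2$, then $$SO(T_\Gamma(\mathbb{Z}_n)) = \frac{\phi(n)(n-\phi(n))^2}{\sqrt{2}} + \frac{(n-\phi(n)-1)^2(n-\phi(n))}{\sqrt{2}}.$$
   Context: For a finite simple graph $G$, the Sombor index is $SO(G)=\sum_{uv\in E(G)}\sqrt{d_u^2+d_v^2}$, the sum being over (unordered) edges, where $d_x$ is the degree of the vertex $x$. For a commutative ring $R$ with unity, $Z(R)$ denotes the set of zero-divisors of $R$, including $0$. The total graph $T_\Gamma(R)$ is the simple graph whose vertices are all elements of $R$, with distinct vertices $x,y$ adjacent if and only if $x+y\in Z(R)$. $\mathbb{Z}_n$ is the ring of integers modulo $n$ and $\phi$ is Euler's totient function. *)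

(* Defs.v *)
From HB Require Import structures.
From mathcomp Require Import all_boot all_order all_algebra.

Set Implicit Arguments.
Unset Strict Implicit.
Unset Printing Implicit Defensive.

Import Order.TTheory GRing.Theory Num.Theory.
Local Open Scope ring_scope.

Record sgraph : Type := SGraph {
  vertex : finType;
  adj : rel vertex;
  adj_sym : symmetric adj;
  adj_irrefl : irreflexive adj
}.

Definition degree (G : sgraph) (x : vertex G) : nat :=
  #|[set y : vertex G | adj x y]|.

(* Unordered edges, as two-element sets of vertices. *)
Definition edges (G : sgraph) : {set {set vertex G}} :=
  [set [set u.1; u.2] | u in [set u : vertex G * vertex G | adj u.1 u.2]].

(* For an edge e = {u, v} the inner sum is d_u ^ 2 + d_v ^ 2, because u != v
   (see [edge_sumE]). *)
Definition sombor (R : rcfType) (G : sgraph) : R :=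
  \sum_(e in edges G) Num.sqrt (\sum_(x in e) (degree x)%:R ^+ 2).

Lemma edge_sumE (R : rcfType) (G : sgraph) (u v : vertex G) :
  adj u v ->
  \sum_(x in [set u; v]) (degree x)%:R ^+ 2 =
    (degree u)%:R ^+ 2 + (degree v)%:R ^+ 2 :> R.
Proof.
move=> uv; have neq_uv : u != v.
  by apply: contraTneq uv => ->; rewrite adj_irrefl.
by rewrite big_setU1 ?inE //= big_set1.
Qed.

(* Zero-divisors, with 0 included: as 1 != 0 in A, the witness y = 1 shows
   that 0 satisfies the condition. *)
Definition zero_divisors (A : finComNzRingType) : {set A} :=
  [set x : A | [exists y : A, (y != 0) && (x * y == 0)]].

Section TotalGraph.
Variable A : finComNzRingType.

Definition total_adj : rel A :=
  [rel x y | (x != y) && (x + y \in zero_divisors A)].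

Lemma total_adj_sym : symmetric total_adj.
Proof. by move=> x y; rewrite /total_adj /= eq_sym addrC. Qed.

Lemma total_adj_irrefl : irreflexive total_adj.
Proof. by move=> x; rewrite /total_adj /= eqxx. Qed.

Definition total_graph : sgraph := SGraph total_adj_sym total_adj_irrefl.

End TotalGraph.

(* Main.v *)
(* A graph in which adjacent vertices have equal degrees satisfies
   SO(G) = (sum over x of d_x ^ 2) / sqrt 2, since each edge then contributes
   sqrt 2 times the degree of its ends. In a finite commutative ring the
   zero-divisors are the non-units, and translation by x shows that x has
   degree |Z(R)| in the total graph, less 1 if 2x is in Z(R). For n even, 2 is
   a zero-divisor and the graph is regular; for n a power of an odd prime, 2 is
   a unit and Z(R) is an ideal, so no edge joins a unit to a zero-divisor. *)
Require Import Defs.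
From HB Require Import structures.
From mathcomp Require Import all_boot all_order all_algebra.

Set Implicit Arguments.
Unset Strict Implicit.
Unset Printing Implicit Defensive.

Import Order.TTheory GRing.Theory Num.Theory.
Local Open Scope ring_scope.

(** An edge {a, b} arises only from (a, b) and (b, a), which differ since there are no loops. *)
Lemma card_edge_fiber (G : sgraph) (e : {set vertex G}) : e \in edges G ->
  #|[set u : vertex G * vertex G | adj u.1 u.2 & [set u.1; u.2] == e]| = 2%N.
Proof.
case/imsetP=> -[a b]; rewrite inE /= => ab ->.
have neq_ab : a != b by apply: contraTneq ab => ->; rewrite adj_irrefl.
transitivity #|[set (a, b); (b, a)]|; last by rewrite cards2 xpair_eqE (negPf neq_ab).
congr #|pred_of_set _|; apply/setP=> -[c d]; rewrite !inE !xpair_eqE /=.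
apply/andP/orP => [[cd /eqP eq_cd]|[]/andP[/eqP-> /eqP->]]; last 2 first.
- by [].
- by rewrite adj_sym setUC.
have neq_cd : c != d by apply: contraTneq cd => ->; rewrite adj_irrefl.
(* Both [c] and [d] lie in {a, b}; as they are distinct, only the two orders remain. *)
have := set21 c d; have := set22 c d; rewrite eq_cd !inE.
move: neq_cd; case: (c =P a) => [->|_]; case: (d =P b) => [->|_] //=.
- by left.
- by rewrite orbF => /eqP nad /eqP dea; case: nad.
- by move=> /eqP ncb _ /eqP cb; case: ncb.
- by rewrite orbF => _ -> ->; right.
Qed.

(** Handshake argument: group the ordered adjacent pairs by their underlying edge. *)
Lemma sum_adj_edges (V : nmodType) (G : sgraph) (f : {set vertex G} -> V) :
  \sum_(x : vertex G) \sum_(y | adj x y) f [set x; y] =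
    (\sum_(e in edges G) f e) *+ 2.
Proof.
rewrite pair_big_dep /=.
rewrite (partition_big (fun u : vertex G * vertex G => [set u.1; u.2])
  (mem (edges G))) /=; last first.
  by move=> u uv; apply/imsetP; exists u; rewrite ?inE.
rewrite -sumrMnl; apply: eq_bigr => e /card_edge_fiber <-.
rewrite (eq_bigr (fun=> f e)) => [|u /andP[_ /eqP->] //].
by rewrite sumr_const; congr (_ *+ _); apply: eq_card => u; rewrite !inE.
Qed.

Lemma sombor_locally_regular (R : rcfType) (G : sgraph) :
  (forall u v : vertex G, adj u v -> degree u = degree v) ->
  sombor R G = (\sum_(x : vertex G) (degree x)%:R ^+ 2) / Num.sqrt 2%:R.
Proof.
move=> eq_deg.
have sqrt2_neq0 : Num.sqrt 2%:R != 0 :> R by rewrite gt_eqF // sqrtr_gt0 ltr0n.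
apply: (mulIf sqrt2_neq0); rewrite divfK //.
(* A second factor sqrt 2 produces twice the Sombor index, that is, a sum over ordered adjacent
   pairs. *)
apply: (mulIf sqrt2_neq0); rewrite -mulrA -expr2 sqr_sqrtr ?ler0n //.
rewrite mulr_natr -sum_adj_edges mulr_suml; apply: eq_bigr => x _.
rewrite (eq_bigr (fun=> (degree x)%:R * Num.sqrt 2%:R)) => [|y xy]; last first.
  rewrite edge_sumE // -(eq_deg _ _ xy) -mulr2n -[_ *+ 2]mulr_natr.
  by rewrite sqrtrM ?sqr_ge0 // sqrtr_sqr ger0_norm ?ler0n.
rewrite sumr_const -[LHS]mulr_natl expr2 -[RHS]mulrA; congr (_%:R * _).
by apply: eq_card => y; rewrite inE.
Qed.

Section TotalGraphDegree.
Variable A : finComUnitRingType.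

Lemma mem_zero_divisors (x : A) : (x \in zero_divisors A) = (x \isn't a GRing.unit).
Proof.
rewrite inE; apply/existsP/idP => [[y /andP[y0 /eqP xy0]]|xN].
  by apply: contra y0 => xU; rewrite -(mulKr xU y) xy0 mulr0.
(* By finiteness, injective multiplication by [x] would be bijective, and the preimage of 1 would
   invert [x]. So two elements collide, and their difference annihilates [x]. *)
have /injectivePn[y [z neq_yz eq_xyz]] : ~~ injectiveb ( *%R x).
  apply: contra xN => /injectiveP/injF_bij[g _ gK].
  by apply/unitrPr; exists (g 1); apply: gK.
by exists (y - z); rewrite subr_eq0 neq_yz mulrBr eq_xyz subrr eqxx.
Qed.

(** The boolean accounts for y = x, which the translate of the zero-divisors may contain but the
    neighbourhood of [x] never does. *)
Lemma degree_total_graph (x : A) :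
  (((x + x)%R \in zero_divisors A) + @degree (total_graph A) x)%N =
    #|zero_divisors A|.
Proof.
have <- : #|[set y | x + y \in zero_divisors A]| = #|zero_divisors A|.
  rewrite -(card_imset _ (addrI x)); apply: eq_card => z.
  apply/imsetP/idP => [[y]|zZ]; first by rewrite in_set => ? ->.
  by exists (z - x); rewrite 1?in_set addrC subrK.
rewrite (cardsD1 x) [x \in _]in_set; congr (_ + _)%N.
by apply: eq_card => y; rewrite in_setD1 in_set [in RHS]in_set /= eq_sym.
Qed.

End TotalGraphDegree.

Section Zn.
Variable n : nat.
Hypothesis n_gt1 : (1 < n)%N.

Lemma card_Zn : #|'Z_n| = n.
Proof. by rewrite card_ord Zp_cast. Qed.

Lemma card_unit_Zn : #|[pred x : 'Z_n | x \is a GRing.unit]| = totient n.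
Proof. by rewrite -card_units_Zp ?(ltnW n_gt1) // cardsT card_sub. Qed.

Lemma card_zero_divisors_Zn : (#|zero_divisors 'Z_n| + totient n)%N = n.
Proof.
rewrite -[RHS]card_Zn -card_unit_Zn -(cardC [in zero_divisors 'Z_n]).
by congr (_ + _)%N; apply: eq_card => x; rewrite [RHS](congr1 negb (mem_zero_divisors x)) negbK.
Qed.

(** Both [n] and the doubled representative of [x] are even, hence not coprime. *)
Lemma double_zero_divisor_Zn (x : 'Z_n) : ~~ odd n -> x + x \in zero_divisors 'Z_n.
Proof.
move=> n_even; rewrite mem_zero_divisors -[x]natr_Zp -natrD unitZpE //.
rewrite addnn; apply: contraTN isT => /eqP gcd1.
have: (2 %| gcdn n x.*2)%N by rewrite dvdn_gcd !dvdn2 odd_double n_even.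
by rewrite gcd1.
Qed.

Lemma unit_Zn_prime_power (p k m : nat) : prime p -> (0 < k)%N -> n = (p ^ k)%N ->
  ((m%:R : 'Z_n) \is a GRing.unit) = ~~ (p %| m)%N.
Proof. by move=> p_pr k_gt0 n_pk; rewrite unitZpE // {1}n_pk coprime_pexpl // prime_coprime. Qed.

End Zn.

Theorem theorem3p1 (R : rcfType) (n p : nat)
    (hn : (2 <= n)%N) (hp : prime p) :
  (~~ odd n ->
     sombor R (total_graph 'Z_n) =
       n%:R * (n%:R - (totient n)%:R - 1) ^+ 2 / Num.sqrt 2%:R)
  /\
  (forall alpha : nat, (1 <= alpha)%N -> n = (p ^ alpha)%N -> (2 < p)%N ->
     sombor R (total_graph 'Z_n) =
       (totient n)%:R * (n%:R - (totient n)%:R) ^+ 2 / Num.sqrt 2%:R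
       + (n%:R - (totient n)%:R - 1) ^+ 2 * (n%:R - (totient n)%:R)
         / Num.sqrt 2%:R).
Proof.
have cardZ : #|zero_divisors 'Z_n|%:R = n%:R - (totient n)%:R :> R.
  by apply/eqP; rewrite eq_sym subr_eq -natrD card_zero_divisors_Zn.
split=> [n_even | alpha alpha_gt0 n_pa p_gt2].
  have deg x : (@degree (total_graph 'Z_n) x).+1 = #|zero_divisors 'Z_n|.
    by rewrite -(degree_total_graph x) double_zero_divisor_Zn.
  rewrite sombor_locally_regular => [|u v _]; last by apply: succn_inj; rewrite !deg.
  congr (_ / _); rewrite -cardZ.
  rewrite (eq_bigr (fun=> (#|zero_divisors 'Z_n|%:R - 1) ^+ 2)) => [|x _]; last first.
    by rewrite -(deg x) -natr1 addrK.
  by rewrite sumr_const card_Zn // mulr_natl.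
have unitE m := unit_Zn_prime_power hn m hp alpha_gt0 n_pa.
(* By Euclid's lemma, [p] divides 2x only if it divides x, because p > 2. *)
have doubleE (x : 'Z_n) : (x + x \in zero_divisors 'Z_n) = (x \isn't a GRing.unit).
  rewrite mem_zero_divisors -[x]natr_Zp -natrD !unitE addnn -muln2 Euclid_dvdM //.
  by rewrite [(p %| 2)%N]gtnNdvd // orbF.
have deg (x : 'Z_n) : ((x \isn't a GRing.unit) + @degree (total_graph 'Z_n) x)%N =
    #|zero_divisors 'Z_n| by rewrite -(degree_total_graph x) doubleE.
rewrite sombor_locally_regular => [|u v /andP[_]]; last first.
  rewrite mem_zero_divisors => uvN.
  (* By [deg], the degree depends only on being a unit; as [p] divides u + v, it divides both or
     neither. *)
  suff eq_unit : (u \isn't a GRing.unit) = (v \isn't a GRing.unit).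
    by apply: (@addnI (u \isn't a GRing.unit)); rewrite {2}eq_unit !deg.
  move: uvN; rewrite -[u]natr_Zp -[v]natr_Zp -natrD !unitE !negbK => p_uv.
  by apply/idP/idP => p_dv; move: p_uv; [rewrite dvdn_addr | rewrite dvdn_addl].
rewrite -mulrDl; congr (_ / _); rewrite -cardZ.
(* Units have degree |Z|, the other elements |Z| - 1. *)
rewrite (bigID [pred x : 'Z_n | x \is a GRing.unit]) /=; congr (_ + _).
  rewrite (eq_bigr (fun=> #|zero_divisors 'Z_n|%:R ^+ 2)) => [|x xU]; last first.
    by rewrite -(deg x) xU.
  by rewrite sumr_const -(card_unit_Zn hn) mulr_natl.
rewrite (eq_bigr (fun=> (#|zero_divisors 'Z_n|%:R - 1) ^+ 2)) => [|x xN]; last first.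
  by rewrite -(deg x) xN natrD addrAC subrr add0r.
rewrite sumr_const mulr_natr; congr (_ *+ _).
by apply: eq_card => x; rewrite mem_zero_divisors.
Qed.
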